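(* Let $m\in\mathbb{N}$ and $n_1,\dots,n_m\in\mathbb{N}$ be known, $n_\cdot=\sum_{i=1}^m n_i$. Let $X_{i,j}\sim\mathrm{Po}(\lambda_{i,j})$, $j=1,\dots,n_i$, $i=1,\dots,m$, and $Y_i\sim\mathrm{Po}(\lambda_{i,\cdot})$, $i=1,\dots,m$, be mutually independent, where $\lambda_{i,j}\in(0,\infty)$ are unknown and $\lambda_{i,\cdot}=\sum_{j=1}^{n_i}\lambda_{i,j}$. Consider estimation of $\lambda=((\lambda_{i,j})_{j})_{i}$ on the basis of $X=((X_{i,j})_j)_i$ and $Y=(Y_i)_i$ under the entropy loss $$L^{\mathrm{KL}}(\tilde d,\lambda)=\sum_{i=1}^m\sum_{j=1}^{n_i}\Big(\tilde d_{i,j}-\lambda_{i,j}-\lambda_{i,j}\log\frac{\tilde d_{i,j}}{\lambda_{i,j}}\Big).$$ Put $X_{i,\cdot}=\sum_{j}X_{i,j}$, $X_{\cdot,\cdot}=\sum_iX_{i,\cdot}$, $Y_\cdot=\sum_iY_i$. For $\alpha>0$ and $a=(a_1,\dots,a_m)\in(0,\infty)^m$ with $a_\cdot=\sum_{i=1}^m a_i$, define estimators with $(i,j)$ components $$\hat\lambda^{(\alpha;a)}_{i,j}(X,Y)=\frac{X_{\cdot,\cdot}+Y_\cdot+\alpha}{2}\,\frac{X_{i,\cdot}+Y_i+a_i}{X_{\cdot,\cdot}+Y_\cdot+a_\cdot}\,\frac{X_{i,j}+1/2}{X_{i,\cdot}+n_i/2},\qquad \hat\lambda^{\mathrm{J}}_{i,j}(X,Y)=\frac{X_{i,\cdot}+Y_i+n_i/2}{2}\,\frac{X_{i,j}+1/2}{X_{i,\cdot}+n_i/2}.$$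 Suppose that $n_i/2\ge a_i\ge1$ for all $i=1,\dots,m$, that $a_\cdot\ge\alpha\ge1$, and that $\alpha<n_\cdot/2$. Then $\hat\lambda^{\mathrm{J}}(X,Y)$ is dominated by $\hat\lambda^{(\alpha;a)}(X,Y)$.
   Context: $\mathrm{Po}(\mu)$ is the Poisson distribution with mean $\mu$. The risk of an estimator $\delta$ at $\lambda$ is $E_\lambda[L^{\mathrm{KL}}(\delta(X,Y),\lambda)]$. An estimator $\delta$ is dominated by $\delta'$ if the risk of $\delta'$ is at most the risk of $\delta$ for every $\lambda\in(0,\infty)^{n_1}\times\cdots\times(0,\infty)^{n_m}$, with strict inequality for at least one $\lambda$. (Here $\hat\lambda^{\mathrm{J}}$ is the generalized Bayes estimator under the Jeffreys prior, i.e. $\hat\lambda^{(\alpha;a)}$ with $\alpha=n_\cdot/2$, $a_i=n_i/2$.) *)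

(* Defs.v *)
From HB Require Import structures.
From mathcomp Require Import all_boot all_order all_algebra.
From mathcomp Require Import all_classical all_reals all_analysis.

Set Implicit Arguments.
Unset Strict Implicit.
Unset Printing Implicit Defensive.

Import Order.TTheory GRing.Theory Num.Theory.
Import numFieldNormedType.Exports.

Local Open Scope classical_set_scope.
Local Open Scope ring_scope.

(* Ragged families (t_{i,j}), with 1 <= i <= m and 1 <= j <= n_i. *)
Definition array (m : nat) (n : 'I_m -> nat) (T : Type) : Type :=
  forall i : 'I_m, 'I_(n i) -> T.

Definition positive_array (R : realType) (m : nat) (n : 'I_m -> nat)
    (lam : array n R) : Prop :=
  forall i j, 0 < lam i j.

Definition mutually_independent (d d' : measure_display)
    (Omega : measurableType d) (T : measurableType d') (R : realType)
    (P : probability Omega R) (K : finType) (Z : K -> {mfun Omega >-> T})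
    : Prop :=
  forall (J : {set K}) (A : K -> set T), (forall k, measurable (A k)) ->
    P (\bigcap_(k in [set` J]) (Z k @^-1` A k))
    = (\prod_(k in J) P (Z k @^-1` A k))%E.

Definition joint_family (d : measure_display) (Omega : measurableType d)
    (m : nat) (n : 'I_m -> nat)
    (X : array n {mfun Omega >-> nat}) (Y : 'I_m -> {mfun Omega >-> nat})
    (k : {i : 'I_m & 'I_(n i)} + 'I_m) : {mfun Omega >-> nat} :=
  match k with
  | inl ij => X (tag ij) (tagged ij)
  | inr i => Y i
  end.

(* The second argument of [poisson_prob] is a dummy: [poisson_prob r k A] does
   not depend on [k]. *)
Definition has_poisson_law (d : measure_display) (Omega : measurableType d)
    (R : realType) (P : probability Omega R) (Z : {mfun Omega >-> nat})
    (mu : R) : Prop :=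
  forall A : set nat, distribution P Z A = poisson_prob mu 0 A.

(* [P lam] is the law of the data when the true parameter is [lam]; it is
   constrained only for parameters with positive entries. *)
Definition poisson_model (d : measure_display) (Omega : measurableType d)
    (R : realType) (m : nat) (n : 'I_m -> nat)
    (P : array n R -> probability Omega R)
    (X : array n {mfun Omega >-> nat}) (Y : 'I_m -> {mfun Omega >-> nat})
    : Prop :=
  forall lam : array n R, positive_array lam ->
    [/\ forall i j, has_poisson_law (P lam) (X i j) (lam i j),
        forall i, has_poisson_law (P lam) (Y i) (\sum_(j < n i) lam i j) &
        mutually_independent (P lam) (joint_family X Y)].

Definition estimator (R : realType) (m : nat) (n : 'I_m -> nat) : Type :=
  array n nat -> ('I_m -> nat) -> array n R.

(* Meant for arrays [dt] and [lam] with positive entries: [ln] is 0 on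
   nonpositive numbers. *)
Definition kl_loss (R : realType) (m : nat) (n : 'I_m -> nat)
    (dt lam : array n R) : R :=
  \sum_(i < m) \sum_(j < n i)
    (dt i j - lam i j - lam i j * ln (dt i j / lam i j)).

Definition risk (d : measure_display) (Omega : measurableType d)
    (R : realType) (m : nat) (n : 'I_m -> nat)
    (P : array n R -> probability Omega R)
    (X : array n {mfun Omega >-> nat}) (Y : 'I_m -> {mfun Omega >-> nat})
    (delta : estimator R n) (lam : array n R) : \bar R :=
  ('E_(P lam)[fun w =>
     kl_loss (delta (fun i j => X i j w) (fun i => Y i w)) lam])%E.

(* [delta] is dominated by [delta']. *)
Definition risk_dominated (d : measure_display) (Omega : measurableType d)
    (R : realType) (m : nat) (n : 'I_m -> nat)
    (P : array n R -> probability Omega R)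
    (X : array n {mfun Omega >-> nat}) (Y : 'I_m -> {mfun Omega >-> nat})
    (delta delta' : estimator R n) : Prop :=
  (forall lam, positive_array lam ->
     (risk P X Y delta' lam <= risk P X Y delta lam)%E) /\
  (exists2 lam, positive_array lam &
     (risk P X Y delta' lam < risk P X Y delta lam)%E).

Definition row_total (m : nat) (n : 'I_m -> nat) (x : array n nat) (i : 'I_m)
    : nat :=
  (\sum_(j < n i) x i j)%N.

Definition grand_total (m : nat) (n : 'I_m -> nat) (x : array n nat) : nat :=
  (\sum_(i < m) row_total x i)%N.

Definition lambda_hat (R : realType) (m : nat) (n : 'I_m -> nat)
    (alpha : R) (a : 'I_m -> R) : estimator R n :=
  fun x y i j =>
    ((grand_total x + \sum_(k < m) y k)%N%:R + alpha) / 2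
    * (((row_total x i + y i)%N%:R + a i)
       / ((grand_total x + \sum_(k < m) y k)%N%:R + \sum_(k < m) a k))
    * (((x i j)%:R + 1 / 2) / ((row_total x i)%:R + (n i)%:R / 2)).

Definition lambda_hat_J (R : realType) (m : nat) (n : 'I_m -> nat)
    : estimator R n :=
  fun x y i j =>
    ((row_total x i + y i)%N%:R + (n i)%:R / 2) / 2
    * (((x i j)%:R + 1 / 2) / ((row_total x i)%:R + (n i)%:R / 2)).

Lemma lambda_hat_JE (R : realType) (m : nat) (n : 'I_m -> nat)
    (x : array n nat) (y : 'I_m -> nat) (i : 'I_m) (j : 'I_(n i)) :
  lambda_hat_J R x y j
  = lambda_hat ((\sum_(k < m) n k)%N%:R / 2) (fun k => (n k)%:R / 2) x y j.
Proof.
rewrite /lambda_hat_J /lambda_hat [(\sum_(k < m) n k)%:R]natr_sum mulr_suml.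
congr (_ * _); set T := (X in X / 2 * (_ / X)).
have T0 : T != 0.
  rewrite gt_eqF// ltr_wpDl// (bigD1 i)//= ltr_wpDr//.
    by rewrite sumr_ge0// => k _; rewrite divr_ge0.
  by rewrite divr_gt0// ltr0n (leq_trans _ (ltn_ord j)).
by rewrite [RHS]mulrCA [T / 2 / T]mulrAC divff// mul1r.
Qed.

(* Main.v *)
(* The factor (X_{i,j} + 1/2) / (X_{i,.} + n_i/2) sums to 1 over j and is common
   to both estimators, so the loss of lambda^J minus that of lambda^(alpha;a)
   depends on the data only through W_i = X_{i,.} + Y_i, distributed as
   Po(2 lambda_{i,.}), and W_. = sum_i W_i.  It equals
   c = (n_./2 - alpha)/2 minus
     sum_i lambda_{i,.} (ln ((W_i + n_i/2) / (W_i + a_i))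
                         + ln ((W_. + a_.) / (W_. + alpha))),
   and ln ((w + b) / (w + a)) <= (b - a) / (w + 1) when 1 <= a <= b.  Since
   E[mu / (W + 1)] = 1 - exp(-mu) for W ~ Po(mu), the expectation of the
   subtracted term is at most c (1 - exp(-2 lambda_{.,.})) < c. *)
Require Import Defs.
From HB Require Import structures.
From mathcomp Require Import all_boot all_order all_algebra.
From mathcomp Require Import all_classical all_reals all_analysis.
From mathcomp Require Import measurable_realfun ring lra.

Set Implicit Arguments.
Unset Strict Implicit.
Unset Printing Implicit Defensive.

Import Order.TTheory GRing.Theory Num.Theory.
Import numFieldNormedType.Exports.

Local Open Scope classical_set_scope.
Local Open Scope ring_scope.

(** * Measurability of functions of finitely many counts *)

(** For finite [K] there are only countably many value tables [{ffun K -> nat}]; the event is the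
    union, over the tables satisfying [Q], of finite intersections of level sets, so [Q] may be
    arbitrary. *)
Lemma measurable_nat_family (d : measure_display) (Omega : measurableType d)
    (K : finType) (Z : K -> {mfun Omega >-> nat}) (Q : set (K -> nat)) :
  measurable [set w | Q (fun k => Z k w)].
Proof.
rewrite (_ : [set w | _] = \bigcup_(z in [set: {ffun K -> nat}])
    ([set _ | Q z] `&` \bigcap_(k in [set: K]) (Z k @^-1` [set z k]))).
  apply: countable_bigcupT_measurable => [|z]; first exact: countableP.
  apply: measurableI.
    have [Qz|Qz] := pselect (Q z).
      by rewrite (_ : [set _ | _] = setT)//; apply/seteqP; split.
    by rewrite (_ : [set _ | _] = set0)//; apply/seteqP; split.
  by apply: fin_bigcap_measurable => // k _; exact: measurable_funPTI.
apply/seteqP; split=> [w /= Qw|w [z _ [/= Qz zw]]] /=.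
  exists [ffun k => Z k w] => //; split=> /=.
    by congr Q: Qw; apply/funext => k; rewrite ffunE.
  by move=> k _ /=; rewrite ffunE.
by congr Q: Qz; apply/funext => k; rewrite zw.
Qed.

Lemma measurable_fun_nat_family (d d' : measure_display)
    (Omega : measurableType d) (T : measurableType d') (K : finType)
    (Z : K -> {mfun Omega >-> nat}) (g : (K -> nat) -> T) :
  measurable_fun [set: Omega] (fun w => g (fun k => Z k w)).
Proof.
by move=> _ B _; rewrite setTI; exact: (measurable_nat_family Z (g @^-1` B)).
Qed.

(** * Poisson masses and sums of independent Poisson counts *)

(* Unlike [poisson_pmf], whose value at rate [0] is [1], this is additive in
   the rate (under convolution) from the rate [0] on. *)
Definition poisson_mass (R : realType) (mu : R) (k : nat) : R :=
  mu ^+ k / k`!%:R * expR (- mu).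

Lemma poisson_mass_ge0 (R : realType) (mu : R) (k : nat) :
  0 <= mu -> 0 <= poisson_mass mu k.
Proof. by move=> mu0; rewrite !mulr_ge0 ?expR_ge0 ?exprn_ge0. Qed.

Lemma poisson_mass0l (R : realType) (k : nat) :
  poisson_mass 0 k = (k == 0%N)%:R :> R.
Proof.
rewrite /poisson_mass expr0n oppr0 expR0.
by case: k => [|k]; rewrite ?mul0r ?fact0 ?invr1 ?mulr1.
Qed.

(** The size-bias identity, which trades [k.+1] for [mu] while shifting the index; both Poisson
    expectations below rest on it. *)
Lemma poisson_massS (R : realType) (mu : R) (k : nat) :
  k.+1%:R * poisson_mass mu k.+1 = mu * poisson_mass mu k.
Proof.
rewrite /poisson_mass exprS factS natrM.
have k0 : k`!%:R != 0 :> R by rewrite pnatr_eq0 -lt0n fact_gt0.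
by field; rewrite k0 nat1r pnatr_eq0.
Qed.

Lemma poisson_massD (R : realType) (a b : R) (N : nat) :
  poisson_mass (a + b) N
  = \sum_(l < N.+1) poisson_mass a (N - l) * poisson_mass b l.
Proof.
rewrite /poisson_mass exprDn opprD expRD !mulr_suml; apply: eq_bigr => l _.
have lN : (l <= N)%N by rewrite -ltnS.
have n0 j : j`!%:R != 0 :> R by rewrite pnatr_eq0 -lt0n fact_gt0.
rewrite -mulr_natr -(bin_fact lN) !natrM.
have c0 : 'C(N, l)%:R != 0 :> R by rewrite pnatr_eq0 -lt0n bin_gt0.
by field; rewrite !n0 c0.
Qed.

Lemma poisson_prob_set1 (R : realType) (mu : R) (k : nat) :
  0 < mu -> poisson_prob mu 0 [set k] = (poisson_mass mu k)%:E.
Proof.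
by move=> mu0; rewrite /poisson_prob mu0 esum_set1 ?lee_fin ?poisson_pmf_ge0//
  /poisson_pmf mu0.
Qed.

(* The sum of the family over [s] is kept together with an arbitrary
   rectangle in the other coordinates, so that the induction on [s] can apply
   mutual independence without ever splitting the family in two blocks. *)
Lemma poisson_sum_law_joint (d : measure_display) (Omega : measurableType d)
    (R : realType) (P : probability Omega R) (K : finType)
    (Z : K -> {mfun Omega >-> nat}) (mu : K -> R) (s : seq K) :
  (forall k, 0 < mu k) -> (forall k, has_poisson_law P (Z k) (mu k)) ->
  mutually_independent P Z -> uniq s ->
  forall (N : nat) (A : K -> set nat),
  P [set w | (\sum_(k <- s) Z k w)%N = N /\ forall k, k \notin s -> A k (Z k w)]
  = ((poisson_mass (\sum_(k <- s) mu k) N)%:E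
     * \prod_(k | k \notin s) P (Z k @^-1` A k))%E.
Proof.
move=> mu0 lawZ indZ; elim: s => [_ N A|j s IH /= /andP[js us] N A].
  (* The empty sum has rate 0, whose mass is the indicator of [N = 0]; for [N = 0] the claim is
     mutual independence over all of [K]. *)
  rewrite big_nil poisson_mass0l; have [->|N0] := eqVneq N 0%N; last first.
    rewrite mul0e (_ : [set w | _] = set0) ?measure0//; apply/seteqP.
    by split=> // w [/=]; rewrite big_nil => N0'; move: N0; rewrite -N0'.
  rewrite mul1e.
  have -> : (\prod_(k | k \notin [::]) P (Z k @^-1` A k))%E
      = (\prod_(k in [set: K]%SET) P (Z k @^-1` A k))%E.
    by apply: eq_bigl => k; rewrite !inE.
  rewrite -indZ//; congr (P _); apply/seteqP; split=> w /=.
    by move=> [_ wA] k _; exact: wA.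
  move=> wA; split=> [|k _]; first by rewrite big_nil.
  by apply: wA; rewrite /= inE.
(* Split by the value [l] of [Z j]: as [j] is outside [s], [A'] can record this value as a
   constraint of the rectangle. The range [l <= N] keeps the subtraction [N - l] exact. *)
pose A' l k := if k == j then [set l] else A k.
pose F l := [set w | (\sum_(k <- s) Z k w)%N = (N - l)%N /\
  forall k, k \notin s -> A' l k (Z k w)].
have Zj l w : F l w -> Z j w = l.
  by move=> [_ /(_ j js)]; rewrite /A' eqxx.
have -> : [set w | (\sum_(k <- j :: s) Z k w)%N = N /\
    forall k, k \notin j :: s -> A k (Z k w)] = \big[setU/set0]_(l < N.+1) F l.
  rewrite -bigcup_mkord; apply/seteqP; split=> w /=.
    rewrite big_cons => -[ZN wA]; exists (Z j w) => /=.
      by rewrite ltnS -ZN leq_addr.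
    split=> /=; first by rewrite -ZN addKn.
    move=> k ks; rewrite /A'; case: eqP => [->//|/eqP kj].
    by apply: wA; rewrite inE negb_or kj.
  move=> [l /= lN Flw]; rewrite big_cons (Zj _ _ Flw).
  have [-> wA] := Flw; split; first by rewrite subnKC.
  move=> k; rewrite inE negb_or => /andP[kj ks].
  by have := wA k ks; rewrite /A' (negbTE kj).
rewrite measure_bigsetU_ord; last 2 first.
- move=> l; exact: (measurable_nat_family Z
    (fun z => (\sum_(k <- s) z k)%N = (N - l)%N /\
      forall k, k \notin s -> A' l k (z k))).
- by move=> i l _ _ [w [/Zj wi /Zj wl]]; apply: val_inj; rewrite /= -wi.
rewrite big_cons addrC poisson_massD -sumEFin ge0_sume_distrl; last first.
  move=> l _; rewrite lee_fin; apply: mulr_ge0; apply: poisson_mass_ge0.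
    by apply: sumr_ge0 => k _; exact: ltW.
  exact: ltW.
apply: eq_bigr => l _; apply: etrans (IH us (N - l)%N (A' l)) _.
rewrite (bigD1 j)//= /A' eqxx [in RHS]EFinM -[RHS]muleA;
  congr (_ * (_ * _))%E.
  have := lawZ j [set nat_of_ord l].
  by rewrite poisson_prob_set1.
apply: eq_big => [k|k /andP[ks kj]].
  by rewrite inE negb_or andbC.
by rewrite (negbTE kj).
Qed.

Lemma poisson_sum_law (d : measure_display) (Omega : measurableType d)
    (R : realType) (P : probability Omega R) (K : finType)
    (Z : K -> {mfun Omega >-> nat}) (mu : K -> R) (p : pred K) (N : nat) :
  (forall k, 0 < mu k) -> (forall k, has_poisson_law P (Z k) (mu k)) ->
  mutually_independent P Z ->
  P [set w | (\sum_(k | p k) Z k w)%N = N]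
  = (poisson_mass (\sum_(k | p k) mu k) N)%:E.
Proof.
move=> mu0 lawZ indZ; rewrite -[in RHS]big_filter.
have := poisson_sum_law_joint mu0 lawZ indZ
  (filter_uniq p (index_enum_uniq K)) N (fun=> setT).
rewrite [X in (_ * X)%E]big1 ?mule1 => [<-|k _]; last first.
  by rewrite preimage_setT probability_setT.
congr (P _); apply/seteqP; split=> w /=.
  by move=> <-; rewrite big_filter.
by move=> [<- _]; rewrite big_filter.
Qed.

(** * Two Poisson expectations *)

Lemma ge0_integral_nat (d : measure_display) (Omega : measurableType d)
    (R : realType) (P : probability Omega R) (W : {mfun Omega >-> nat})
    (f : nat -> R) : (forall k, 0 <= f k) ->
  (\int[P]_w (f (W w))%:E = \sum_(k <oo) (f k)%:E * P (W @^-1` [set k]))%E.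
Proof.
move=> f0.
have mW k : measurable (W @^-1` [set k]) by exact: measurable_funPTI.
have mf : measurable_fun [set: Omega] (EFin \o f \o W).
  apply/measurable_EFinP => _ B _; rewrite setTI.
  have mfB : measurable (f @^-1` B) by [].
  exact: (measurable_funPTI W mfB).
have -> : [set: Omega] = \bigcup_k (W @^-1` [set k]).
  by apply/seteqP; split=> // w _; exists (W w).
rewrite ge0_integral_bigcup//; last 3 first.
- exact: measurable_funTS.
- by move=> w _; rewrite lee_fin.
- by move=> i j _ _ [w [/= <- <-]].
apply: eq_eseriesr => k _; rewrite -integral_cst//.
by apply: eq_integral => w; rewrite inE /= => ->.
Qed.

(** Integrating the constant 1 along the level sets of [W] gives the total mass of [P], with no
    recourse to the exponential series. *)
Lemma sum_poisson_mass (d : measure_display) (Omega : measurableType d)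
    (R : realType) (P : probability Omega R) (W : {mfun Omega >-> nat})
    (mu : R) :
  (forall N, P (W @^-1` [set N]) = (poisson_mass mu N)%:E) ->
  (\sum_(k <oo) (poisson_mass mu k)%:E = 1)%E.
Proof.
move=> lawW; rewrite -[RHS](probability_setT P) -[RHS]mul1e -integral_cst//.
rewrite (@ge0_integral_nat _ _ _ _ W (fun=> 1))//.
by apply: eq_eseriesr => k _; rewrite lawW mul1e.
Qed.

Lemma poisson_expectation (d : measure_display) (Omega : measurableType d)
    (R : realType) (P : probability Omega R) (W : {mfun Omega >-> nat})
    (mu : R) : 0 <= mu ->
  (forall N, P (W @^-1` [set N]) = (poisson_mass mu N)%:E) ->
  (\int[P]_w ((W w)%:R)%:E = mu%:E)%E.
Proof.
move=> mu0 lawW; rewrite (@ge0_integral_nat _ _ _ _ W (fun k => k%:R))//.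
have mass0 := poisson_mass_ge0 _ mu0.
(* The term at 0 vanishes; after the shift, [poisson_massS] leaves [mu] times the total mass. *)
rewrite nneseries_recl//; last by move=> k _; rewrite lawW mule_ge0 ?lee_fin.
rewrite mul0e add0e -nneseries_addn; last first.
  by move=> k; rewrite lawW mule_ge0 ?lee_fin.
rewrite -[RHS]mule1 -(sum_poisson_mass lawW) -nneseriesZl; last first.
  by move=> k _; rewrite lee_fin.
by apply: eq_eseriesr => k _; rewrite addn1 lawW -!EFinM poisson_massS.
Qed.

(** By [poisson_massS], [mu / k.+1] times the mass at [k] is the mass at [k.+1]; the series is thus
    the total mass without its term at 0, which is [expR (- mu)]. *)
Lemma poisson_expectation_inv (d : measure_display) (Omega : measurableType d)
    (R : realType) (P : probability Omega R) (W : {mfun Omega >-> nat})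
    (mu : R) : 0 <= mu ->
  (forall N, P (W @^-1` [set N]) = (poisson_mass mu N)%:E) ->
  (\int[P]_w (mu / (W w).+1%:R)%:E = (1 - expR (- mu))%:E)%E.
Proof.
move=> mu0 lawW; rewrite (@ge0_integral_nat _ _ _ _ W (fun k => mu / k.+1%:R));
  last first.
  by move=> k; rewrite divr_ge0.
have mass0 := poisson_mass_ge0 _ mu0.
have := sum_poisson_mass lawW.
rewrite nneseries_recl//; last by move=> k _; rewrite lee_fin.
rewrite -nneseries_addn; last by move=> k; rewrite lee_fin.
rewrite {1}/poisson_mass expr0 fact0 divr1 mul1r => sum1.
rewrite EFinB -sum1 addeAC subee// add0e.
apply: eq_eseriesr => k _; rewrite addn1 lawW -EFinM; congr (_%:E).
have k0 : k.+1%:R != 0 :> R by rewrite pnatr_eq0.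
by apply: (mulfI k0); rewrite poisson_massS mulrA [_ * (mu / _)]mulrC divfK.
Qed.

(** * Bounds on the logarithm and on one term of the entropy loss *)

Lemma ln_sub_le (R : realType) (u v : R) : 0 < u -> 0 < v ->
  ln u - ln v <= u / v - 1.
Proof.
move=> u0 v0; rewrite -ln_div ?posrE//.
have uv0 : 0 < u / v by rewrite divr_gt0.
rewrite -[in leLHS](subrKC 1 (u / v)); apply: le_ln1Dx.
by rewrite ltrBrDl subrr.
Qed.

Lemma kl_term_ge0 (R : realType) (t l : R) : 0 < t -> 0 < l ->
  0 <= t - l - l * ln (t / l).
Proof.
move=> t0 l0; rewrite ln_div ?posrE//.
have := ler_wpM2l (ltW l0) (ln_sub_le t0 l0).
have -> : l * (t / l - 1) = t - l by field; exact: lt0r_neq0.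
lra.
Qed.

(** Combine [ln l - ln t <= l / t - 1] with [1 / t <= 4]. The threshold 1/4 is a lower bound for
    every component of [lambda_hat_J], as checked in [kl_loss_J_le]. *)
Lemma kl_term_le (R : realType) (t l : R) : 1 / 4 <= t -> 0 < l ->
  t - l - l * ln (t / l) <= t + 4 * l ^+ 2.
Proof.
move=> t4 l0; have t0 : 0 < t by lra.
rewrite ln_div ?posrE//.
have := ler_wpM2l (ltW l0) (ln_sub_le l0 t0); rewrite mulrBr => h.
suff : l * (l / t) <= 4 * l ^+ 2 by lra.
rewrite mulrA -expr2 ler_pdivrMr// mulrAC ler_peMl ?sqr_ge0//; lra.
Qed.

(** The bound [ln_sub_le] produces the denominator [w + a]; [1 <= a] lowers it to [w + 1], whose
    reciprocal has an explicit Poisson mean. *)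
Lemma ln_shift_le (R : realType) (w a b : R) : 0 <= w -> 1 <= a -> a <= b ->
  ln (w + b) - ln (w + a) <= (b - a) / (w + 1).
Proof.
move=> w0 a1 ab; apply: le_trans (ln_sub_le _ _) _; [lra|lra|].
have -> : (w + b) / (w + a) - 1 = (b - a) / (w + a).
  by field; apply/lt0r_neq0; lra.
apply: ler_wpM2l; first lra.
by rewrite lef_pV2 ?posrE; lra.
Qed.

(** * Pointwise bounds on the losses of the two estimators *)

(** With a common shape [p], the terms in [ln (p j)] and [ln (l j)] cancel and only the scales [r]
    and [s] remain. *)
Lemma kl_rescale (R : realType) (I : finType) (p l : I -> R) (r s : R) :
  0 < r -> 0 < s -> (forall j, 0 < p j) -> (forall j, 0 < l j) ->
  \sum_j p j = 1 ->
  \sum_j (s * p j - l j - l j * ln (s * p j / l j))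
  = \sum_j (r * p j - l j - l j * ln (r * p j / l j))
    + (s - r) + (\sum_j l j) * (ln r - ln s).
Proof.
move=> r0 s0 p0 l0 p1.
rewrite -[s - r]mulr1 -p1 mulr_sumr mulr_suml -!big_split /=.
apply: eq_bigr => j _; rewrite !ln_div ?lnM ?posrE ?mulr_gt0//.
by ring.
Qed.

Lemma shape_sum (R : realType) (k : nat) (x : 'I_k -> nat) : (0 < k)%N ->
  \sum_(j < k) ((x j)%:R + 1 / 2) / ((\sum_(j < k) x j)%N%:R + k%:R / 2)
  = 1 :> R.
Proof.
move=> k0; rewrite -mulr_suml big_split /= -natr_sum sumr_const card_ord.
have -> : 1 / 2 *+ k = k%:R / 2 :> R by rewrite -mulr_natr mul1r mulrC.
rewrite divff// gt_eqF// ltr_wpDl//.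
by rewrite divr_gt0 ?ltr0n.
Qed.

Lemma lambda_hat_J_gt0 (R : realType) (m : nat) (n : 'I_m -> nat)
    (x : array n nat) (y : 'I_m -> nat) (i : 'I_m) (j : 'I_(n i)) :
  0 < lambda_hat_J R x y j.
Proof.
have : 0 < (n i)%:R :> R by rewrite ltr0n (leq_trans _ (ltn_ord j)).
move=> ni.
by rewrite mulr_gt0// divr_gt0// ltr_wpDl// divr_gt0.
Qed.

Lemma lambda_hat_gt0 (R : realType) (m : nat) (n : 'I_m -> nat)
    (x : array n nat) (y : 'I_m -> nat)
    (alpha : R) (a : 'I_m -> R) (i : 'I_m) (j : 'I_(n i)) :
  0 < alpha -> (forall i, 0 < a i) -> 0 < lambda_hat alpha a x y j.
Proof.
move=> al a0; rewrite /lambda_hat.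
have A0 : 0 < \sum_k a k.
  by rewrite (bigD1 i)//= ltr_pwDl// sumr_ge0// => k _; exact: ltW.
have ni : 0 < (n i)%:R :> R by rewrite ltr0n (leq_trans _ (ltn_ord j)).
by rewrite !mulr_gt0 ?invr_gt0// ltr_wpDl// divr_gt0.
Qed.

Lemma kl_loss_ge0 (R : realType) (m : nat) (n : 'I_m -> nat)
    (t lam : array n R) :
  positive_array lam -> positive_array t -> 0 <= kl_loss t lam.
Proof.
by move=> l0 t0; do 2 (apply: sumr_ge0 => ? _); exact: kl_term_ge0.
Qed.

Lemma kl_loss_J_le (R : realType) (m : nat) (n : 'I_m -> nat)
    (x : array n nat) (y : 'I_m -> nat)
    (lam : array n R) : (forall i, 0 < n i)%N -> positive_array lam ->
  kl_loss (lambda_hat_J R x y) lam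
  <= (\sum_(i < m) (row_total x i + y i))%N%:R
     + \sum_(i < m) ((n i)%:R / 4 + 4 * \sum_(j < n i) lam i j ^+ 2).
Proof.
move=> n_gt0 lam_gt0; rewrite natr_sum -big_split /=; apply: ler_sum => i _.
have := n_gt0 i; rewrite -(ler_nat R) => ni.
set W := (row_total x i + y i)%N; have W0 : 0 <= W%:R :> R by [].
have WX : (row_total x i)%:R <= W%:R :> R by rewrite ler_nat leq_addr.
have X0 : 0 <= (row_total x i)%:R :> R by [].
apply: (@le_trans _ _ (\sum_(j < n i)
   (lambda_hat_J R x y j + 4 * lam i j ^+ 2))).
  apply: ler_sum => j _; apply: kl_term_le => //.
  (* The component is at least 1/4: the row total of [x] is at most [W], and [x i j + 1 / 2] is at
     least 1/2. *)
  rewrite /lambda_hat_J -/W mulrA ler_pdivlMr; last lra.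
  have xj : 0 <= (x i j)%:R :> R by [].
  nra.
have -> : W%:R + ((n i)%:R / 4 + 4 * \sum_(j < n i) lam i j ^+ 2)
    = (W%:R + (n i)%:R / 4) + 4 * \sum_(j < n i) lam i j ^+ 2 by rewrite addrA.
rewrite big_split /= [4 * _]mulr_sumr lerD2r.
rewrite /lambda_hat_J -mulr_sumr shape_sum//.
by rewrite -/W; lra.
Qed.

(** The weights are halved and the rates doubled to match the form [mu / W.+1] of
    [poisson_expectation_inv]. Only sums occur, so both sides are nonnegative and can be integrated
    directly. *)
Lemma kl_loss_gap (R : realType) (m : nat) (n : 'I_m -> nat)
    (x : array n nat) (y : 'I_m -> nat)
    (lam : array n R) (alpha : R) (a : 'I_m -> R) :
  (forall i, 0 < n i)%N -> positive_array lam ->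
  (forall i, 1 <= a i <= (n i)%:R / 2) -> 1 <= alpha <= \sum_(i < m) a i ->
  kl_loss (lambda_hat alpha a x y) lam
    + ((\sum_(i < m) n i)%N%:R / 2 - alpha) / 2
  <= kl_loss (lambda_hat_J R x y) lam
    + (\sum_(i < m) ((n i)%:R / 2 - a i) / 2
         * (2 * (\sum_(j < n i) lam i j) / (row_total x i + y i).+1%:R)
       + (\sum_(i < m) a i - alpha) / 2
         * (2 * (\sum_(i < m) \sum_(j < n i) lam i j)
            / (\sum_(i < m) (row_total x i + y i)%N).+1%:R)).
Proof.
move=> n_gt0 lam_gt0 ab /andP[al1 alA].
set A := \sum_(i < m) a i in alA *.
pose w i : R := (row_total x i + y i)%N%:R.
pose W : R := \sum_i w i.
pose L i := \sum_(j < n i) lam i j.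
have w0 i : 0 <= w i by [].
have W0 : 0 <= W by rewrite sumr_ge0.
have WE : (grand_total x + \sum_(k < m) y k)%N%:R = W.
  by rewrite /W -natr_sum big_split.
(* [r i] and [s i] are the sums over row [i] of the Jeffreys estimate and of its competitor, that
   is, the scales of the common shape. *)
pose r i := (w i + (n i)%:R / 2) / 2.
pose s i := (W + alpha) / 2 * ((w i + a i) / (W + A)).
have s0 i : 0 < s i.
  have /andP[a1 _] := ab i; have wi0 := w0 i.
  by rewrite mulr_gt0 ?divr_gt0//; lra.
have r0 i : 0 < r i by have /andP[] := ab i; have := w0 i; rewrite /r; lra.
(* The [ln 2] cancels and [ln_shift_le] applies twice: to row [i] with shifts [a i] and [n i / 2],
   and to the grand total with shifts [alpha] and [A]. *)
have rs i : ln (r i) - ln (s i)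
    <= ((n i)%:R / 2 - a i) / (w i + 1) + (A - alpha) / (W + 1).
  have /andP[a1 an] := ab i; have wi0 := w0 i.
  have := ln_shift_le wi0 a1 an; have := ln_shift_le W0 al1 alA.
  have -> : ln (r i) = ln (w i + (n i)%:R / 2) - ln 2.
    by rewrite /r ln_div ?posrE//; lra.
  have -> : ln (s i)
      = ln (W + alpha) - ln 2 + (ln (w i + a i) - ln (W + A)).
    by rewrite /s lnM ?ln_div ?posrE ?divr_gt0//; lra.
  lra.
(* Whatever the data, the sums of [r] and [s] differ by a constant, the one added on the left of the
   goal. *)
have sumr : \sum_i r i = (W + (\sum_(i < m) n i)%N%:R / 2) / 2.
  by rewrite -mulr_suml big_split /= -mulr_suml natr_sum.
have sums : \sum_i s i = (W + alpha) / 2.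
  rewrite -mulr_sumr -mulr_suml big_split /= divff ?mulr1//.
  by apply/lt0r_neq0; rewrite -/A -/W; lra.
have row i : \sum_(j < n i) (lambda_hat alpha a x y j - lam i j
      - lam i j * ln (lambda_hat alpha a x y j / lam i j))
    <= \sum_(j < n i) (lambda_hat_J R x y j - lam i j
      - lam i j * ln (lambda_hat_J R x y j / lam i j))
    + (s i - r i) + L i * (((n i)%:R / 2 - a i) / (w i + 1)
                           + (A - alpha) / (W + 1)).
  rewrite /lambda_hat /lambda_hat_J WE -/(w i) -/A -/(s i) -/(r i).
  have p0 (j : 'I_(n i)) : 0 < ((x i j)%:R + 1 / 2)
      / ((row_total x i)%:R + (n i)%:R / 2) :> R.
    by rewrite divr_gt0 ?ltr_wpDl ?divr_gt0 ?ltr0n.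
  rewrite (kl_rescale (r0 i) (s0 i) p0 (lam_gt0 i)); last exact: shape_sum.
  by rewrite lerD2l ler_wpM2l// sumr_ge0// => j _; exact: ltW.
have -> : \sum_(i < m) ((n i)%:R / 2 - a i) / 2
      * (2 * (\sum_(j < n i) lam i j) / (row_total x i + y i).+1%:R)
    = \sum_(i < m) L i * (((n i)%:R / 2 - a i) / (w i + 1)).
  apply: eq_bigr => i _; rewrite -[(_ + _).+1%:R]natr1 -/(w i) -/(L i).
  by field; apply/lt0r_neq0; have := w0 i; lra.
have -> : (A - alpha) / 2 * (2 * (\sum_(i < m) \sum_(j < n i) lam i j)
      / (\sum_(i < m) (row_total x i + y i)%N).+1%:R)
    = (\sum_(i < m) L i) * ((A - alpha) / (W + 1)).
  rewrite -[(\sum_(i < m) _).+1%:R]natr1 natr_sum -/W.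
  by field; apply/lt0r_neq0; lra.
apply: (@le_trans _ _ (\sum_(i < m) (\sum_(j < n i) (lambda_hat_J R x y j
    - lam i j - lam i j * ln (lambda_hat_J R x y j / lam i j))
    + (s i - r i) + L i * (((n i)%:R / 2 - a i) / (w i + 1)
                           + (A - alpha) / (W + 1)))
    + ((\sum_(i < m) n i)%N%:R / 2 - alpha) / 2)).
  by rewrite lerD2r; exact: ler_sum.
rewrite !big_split /= sumrN sums sumr -/(kl_loss _ _).
have -> : \sum_(i < m) L i
      * (((n i)%:R / 2 - a i) / (w i + 1) + (A - alpha) / (W + 1))
    = \sum_(i < m) L i * (((n i)%:R / 2 - a i) / (w i + 1))
      + (\sum_(i < m) L i) * ((A - alpha) / (W + 1)).
  by rewrite mulr_suml -big_split; apply: eq_bigr => i _; rewrite mulrDr.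
lra.
Qed.

(** * Laws of the row totals and of the grand total *)

Definition joint_row (m : nat) (n : 'I_m -> nat)
    (k : {i : 'I_m & 'I_(n i)} + 'I_m) : 'I_m :=
  match k with inl ij => tag ij | inr i => i end.

Definition joint_rate (R : realType) (m : nat) (n : 'I_m -> nat)
    (lam : array n R) (k : {i : 'I_m & 'I_(n i)} + 'I_m) : R :=
  match k with
  | inl ij => lam (tag ij) (tagged ij)
  | inr i => \sum_(j < n i) lam i j
  end.

(** The fiber over row [i] consists of its columns and the single index of [Y i]. A general
    commutative monoid covers both the counts in [nat] and the rates in [R]. *)
Lemma big_joint_row (V : Type) (idx : V) (op : Monoid.com_law idx) (m : nat)
    (n : 'I_m -> nat) (F : {i : 'I_m & 'I_(n i)} + 'I_m -> V) (i : 'I_m) :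
  \big[op/idx]_(k | joint_row k == i) F k
  = op (\big[op/idx]_(j < n i) F (inl (Tagged (fun i => 'I_(n i)) j)))
       (F (inr i)).
Proof.
rewrite big_sumType /= big_pred1_eq; congr (op _ _).
rewrite -[RHS](big_pred1_eq op i (fun i =>
  \big[op/idx]_(j < n i) F (inl (Tagged (fun i => 'I_(n i)) j)))).
rewrite (sig_big_dep _ (fun _ => xpredT)
  (fun i j => F (inl (Tagged (fun i => 'I_(n i)) j)))) /=.
by apply: eq_big => [[i' j]|[i' j] _] //=; rewrite andbT.
Qed.

(** Named so that the instance below can register it as a [{mfun Omega >-> nat}], the form taken by
    the expectation lemmas. *)
Definition family_sum (d : measure_display) (Omega : measurableType d)
    (K : finType) (Z : K -> {mfun Omega >-> nat}) (p : pred K) (w : Omega)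
    : nat :=
  (\sum_(k | p k) Z k w)%N.

HB.instance Definition _ (d : measure_display) (Omega : measurableType d)
    (K : finType) (Z : K -> {mfun Omega >-> nat}) (p : pred K) :=
  isMeasurableFun.Build _ _ _ _ (family_sum Z p)
    (measurable_fun_nat_family Z (fun z => (\sum_(k | p k) z k)%N)).

Lemma row_family_sum (d : measure_display) (Omega : measurableType d)
    (m : nat) (n : 'I_m -> nat) (X : array n {mfun Omega >-> nat})
    (Y : 'I_m -> {mfun Omega >-> nat}) (i : 'I_m) (w : Omega) :
  (row_total (fun i j => X i j w) i + Y i w)%N
  = family_sum (joint_family X Y) (fun k => joint_row k == i) w.
Proof. by rewrite /family_sum big_joint_row. Qed.

Lemma total_family_sum (d : measure_display) (Omega : measurableType d)
    (m : nat) (n : 'I_m -> nat) (X : array n {mfun Omega >-> nat})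
    (Y : 'I_m -> {mfun Omega >-> nat}) (w : Omega) :
  (\sum_(i < m) (row_total (fun i j => X i j w) i + Y i w))%N
  = family_sum (joint_family X Y) xpredT w.
Proof.
rewrite /family_sum (partition_big (@joint_row m n) xpredT)//=.
by apply: eq_bigr => i _; rewrite row_family_sum.
Qed.

(** The factor 2 appears because [Y i] has the same rate as the whole row of [X]. *)
Lemma sum_joint_rate_row (R : realType) (m : nat) (n : 'I_m -> nat)
    (lam : array n R) (i : 'I_m) :
  \sum_(k | joint_row k == i) joint_rate lam k = 2 * \sum_(j < n i) lam i j.
Proof. by rewrite big_joint_row /=; ring. Qed.

Lemma sum_joint_rate (R : realType) (m : nat) (n : 'I_m -> nat)
    (lam : array n R) :
  \sum_k joint_rate lam k = 2 * \sum_(i < m) \sum_(j < n i) lam i j.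
Proof.
rewrite (partition_big (@joint_row m n) xpredT)//= mulr_sumr.
by apply: eq_bigr => i _; rewrite sum_joint_rate_row.
Qed.

Lemma joint_family_law (d : measure_display) (Omega : measurableType d)
    (R : realType) (m : nat) (n : 'I_m -> nat)
    (P : array n R -> probability Omega R)
    (X : array n {mfun Omega >-> nat}) (Y : 'I_m -> {mfun Omega >-> nat})
    (lam : array n R) (p : pred ({i : 'I_m & 'I_(n i)} + 'I_m)) (N : nat) :
  (forall i, 0 < n i)%N -> poisson_model P X Y -> positive_array lam ->
  P lam (family_sum (joint_family X Y) p @^-1` [set N])
  = (poisson_mass (\sum_(k | p k) joint_rate lam k) N)%:E.
Proof.
move=> n_gt0 model lam0; have [lawX lawY ind] := model _ lam0.
apply: poisson_sum_law => //; last first.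
  by case=> [[i j]|i]; [exact: lawX|exact: lawY].
case=> [[i j]|i]; first exact: lam0.
rewrite /= (bigD1 (Ordinal (n_gt0 i)))//= ltr_pwDl//.
by rewrite sumr_ge0// => j _; exact: ltW.
Qed.

(** * Comparison of the risks *)

Lemma risk_ge0 (d : measure_display) (Omega : measurableType d)
    (R : realType) (m : nat) (n : 'I_m -> nat)
    (P : array n R -> probability Omega R)
    (X : array n {mfun Omega >-> nat}) (Y : 'I_m -> {mfun Omega >-> nat})
    (delta : estimator R n) (lam : array n R) :
  positive_array lam -> (forall x y, positive_array (delta x y)) ->
  (0 <= risk P X Y delta lam)%E.
Proof.
by move=> lam0 delta0; apply: expectation_ge0 => w; exact: kl_loss_ge0.
Qed.

Lemma measurable_loss (d : measure_display) (Omega : measurableType d)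
    (R : realType) (m : nat) (n : 'I_m -> nat)
    (X : array n {mfun Omega >-> nat}) (Y : 'I_m -> {mfun Omega >-> nat})
    (delta : estimator R n) (lam : array n R) :
  measurable_fun [set: Omega] (fun w =>
    (kl_loss (delta (fun i j => X i j w) (fun i => Y i w)) lam)%:E).
Proof.
exact: (measurable_fun_nat_family (joint_family X Y) (fun z =>
  (kl_loss (delta (fun i j => z (inl (Tagged (fun i => 'I_(n i)) j)))
                  (fun i => z (inr i))) lam)%:E)).
Qed.

(** Each summand is a weight times [mu / W.+1] with [W] Poisson of mean [mu], so
    [poisson_expectation_inv] applies; the mean of a row is at most that of the grand total, which
    gives a common exponential. *)
Lemma expectation_gap_bound (d : measure_display) (Omega : measurableType d)
    (R : realType) (m : nat) (n : 'I_m -> nat)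
    (P : array n R -> probability Omega R)
    (X : array n {mfun Omega >-> nat}) (Y : 'I_m -> {mfun Omega >-> nat})
    (lam : array n R) (c : 'I_m -> R) (C : R) :
  (forall i, 0 < n i)%N -> poisson_model P X Y -> positive_array lam ->
  (forall i, 0 <= c i) -> 0 <= C ->
  (\int[P lam]_w (\sum_(i < m) c i
         * (2 * (\sum_(j < n i) lam i j)
            / (row_total (fun i j => X i j w) i + Y i w).+1%:R)
       + C * (2 * (\sum_(i < m) \sum_(j < n i) lam i j)
            / (\sum_(i < m) (row_total (fun i j => X i j w) i
                             + Y i w)%N).+1%:R))%:E
  <= ((\sum_(i < m) c i + C)
      * (1 - expR (- (2 * \sum_(i < m) \sum_(j < n i) lam i j))))%:E)%E.
Proof.
move=> n_gt0 model lam0 c0 C0.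
set L := \sum_(i < m) _.
have sum_row_ge0 i : 0 <= \sum_(j < n i) lam i j.
  by rewrite sumr_ge0// => j _; exact: ltW.
have Li0 i : 0 <= 2 * \sum_(j < n i) lam i j by rewrite mulr_ge0.
have L0 : 0 <= 2 * L by rewrite mulr_ge0// sumr_ge0.
pose W p := family_sum (joint_family X Y) p.
pose f (c' mu : R) p w : \bar R := (c' * (mu / (W p w).+1%:R))%:E.
have f0 c' mu p w : 0 <= c' -> 0 <= mu -> (0 <= f c' mu p w)%E.
  by move=> *; rewrite lee_fin mulr_ge0// divr_ge0.
have mf c' mu p : measurable_fun [set: Omega] (f c' mu p).
  exact: (measurable_fun_nat_family (joint_family X Y)
    (fun z => (c' * (mu / (\sum_(k | p k) z k)%N.+1%:R))%:E)).
have Ef c' mu p : 0 <= c' -> 0 <= mu ->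
    \sum_(k | p k) joint_rate lam k = mu ->
    (\int[P lam]_w f c' mu p w = (c' * (1 - expR (- mu)))%:E)%E.
  move=> c'0 mu0 pmu; rewrite /f.
  under eq_integral do rewrite EFinM.
  rewrite ge0_integralZl_EFin//; last 2 first.
  - by move=> w _; rewrite lee_fin divr_ge0.
  - exact: (measurable_fun_nat_family (joint_family X Y)
      (fun z => (mu / (\sum_(k | p k) z k)%N.+1%:R)%:E)).
  rewrite (@poisson_expectation_inv _ _ _ _ (W p))//.
  by move=> N; rewrite joint_family_law// pmu.
under eq_integral => w _.
  rewrite EFinD -sumEFin total_family_sum.
  under eq_bigr do rewrite row_family_sum.
  over.
rewrite /= ge0_integralD//; last 4 first.
- move=> w _; apply: sume_ge0 => i _.
  exact: (f0 _ _ (fun k => joint_row k == i) _ (c0 i) (Li0 i)).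
- apply: emeasurable_sum => i.
  exact: (mf _ _ (fun k => joint_row k == i)).
- by move=> w _; exact: (f0 _ _ xpredT _ C0 L0).
- exact: (mf _ _ xpredT).
rewrite (Ef _ _ xpredT)//; last exact: sum_joint_rate.
rewrite ge0_integral_sum//; last 2 first.
- by move=> i; exact: (mf _ _ (fun k => joint_row k == i)).
- move=> i w _.
  exact: (f0 _ _ (fun k => joint_row k == i) _ (c0 i) (Li0 i)).
rewrite [X in (_ <= X%:E)%E]mulrDl EFinD leeD2r// mulr_suml -sumEFin.
apply: lee_sum => // i _.
rewrite (Ef _ _ (fun k => joint_row k == i) (c0 i) (Li0 i)); last first.
  exact: sum_joint_rate_row.
rewrite lee_fin ler_wpM2l// lerD2l lerN2 ler_expR lerN2 ler_pM2l//.
by rewrite /L (bigD1 i)//= lerDl; apply: sumr_ge0 => k _; exact: sum_row_ge0.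
Qed.

(** Strict domination needs this: adding an infinite risk would destroy a strict inequality. The
    loss is at most the grand total plus a constant, and the grand total has a finite Poisson
    mean. *)
Lemma risk_J_fin (d : measure_display) (Omega : measurableType d)
    (R : realType) (m : nat) (n : 'I_m -> nat)
    (P : array n R -> probability Omega R)
    (X : array n {mfun Omega >-> nat}) (Y : 'I_m -> {mfun Omega >-> nat})
    (lam : array n R) :
  (forall i, 0 < n i)%N -> poisson_model P X Y -> positive_array lam ->
  (risk P X Y (lambda_hat_J R (n := n)) lam < +oo)%E.
Proof.
move=> n_gt0 model lam0.
set C := \sum_(i < m) ((n i)%:R / 4 + 4 * \sum_(j < n i) lam i j ^+ 2).
have C0 : 0 <= C.
  apply: sumr_ge0 => i _; rewrite addr_ge0 ?divr_ge0 ?mulr_ge0//.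
  by apply: sumr_ge0 => j _; exact: sqr_ge0.
pose W := family_sum (joint_family X Y) xpredT.
have mW : measurable_fun [set: Omega] (fun w => ((W w)%:R : R)%:E).
  exact: (measurable_fun_nat_family (joint_family X Y)
    (fun z => ((\sum_k z k)%N%:R : R)%:E)).
apply: (@le_lt_trans _ _ (\int[P lam]_w (((W w)%:R : R)%:E + C%:E))%E).
  rewrite /risk unlock; apply: ge0_le_integral => //.
  - move=> w _; rewrite lee_fin; apply: kl_loss_ge0 => // i j.
    exact: lambda_hat_J_gt0.
  - exact: (measurable_loss X Y (lambda_hat_J R (n := n)) lam).
  - exact: emeasurable_funD.
  - move=> w _; rewrite -EFinD lee_fin /W -total_family_sum.
    exact: kl_loss_J_le.
rewrite ge0_integralD//.
rewrite (@poisson_expectation _ _ _ _ W (\sum_k joint_rate lam k)).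
- by rewrite integral_cst//= probability_setT mule1 -EFinD ltry.
- rewrite sum_joint_rate mulr_ge0//.
  by do 2 (apply: sumr_ge0 => ? _); exact: ltW.
- by move=> N; rewrite joint_family_law.
Qed.

(** Integrates [kl_loss_gap] and applies [expectation_gap_bound]. Using sums avoids subtracting
    risks, which are extended reals. *)
Lemma risk_gap (d : measure_display) (Omega : measurableType d)
    (R : realType) (m : nat) (n : 'I_m -> nat)
    (P : array n R -> probability Omega R)
    (X : array n {mfun Omega >-> nat}) (Y : 'I_m -> {mfun Omega >-> nat})
    (alpha : R) (a : 'I_m -> R) (lam : array n R) :
  (forall i, 0 < n i)%N -> poisson_model P X Y -> positive_array lam ->
  (forall i, 1 <= a i <= (n i)%:R / 2) -> 1 <= alpha <= \sum_(i < m) a i ->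
  (risk P X Y (lambda_hat (n := n) alpha a) lam
     + (((\sum_(i < m) n i)%N%:R / 2 - alpha) / 2)%:E
   <= risk P X Y (lambda_hat_J R (n := n)) lam
      + (((\sum_(i < m) n i)%N%:R / 2 - alpha) / 2
         * (1 - expR (- (2 * \sum_(i < m) \sum_(j < n i) lam i j))))%:E)%E.
Proof.
move=> n_gt0 model lam0 ab alphab.
set c := ((\sum_(i < m) n i)%N%:R / 2 - alpha) / 2.
(* The sum of the [a i] cancels, so the weights of the rows and of the grand total add up to exactly
   [c]. *)
have c_split : c = \sum_(i < m) ((n i)%:R / 2 - a i) / 2
                   + (\sum_(i < m) a i - alpha) / 2.
  by rewrite -mulr_suml sumrB -mulr_suml -natr_sum /c; field.
have b0 i : 0 <= ((n i)%:R / 2 - a i) / 2 by have /andP[] := ab i; lra.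
have A0 : 0 <= (\sum_(i < m) a i - alpha) / 2 by case/andP: alphab; lra.
have c0 : 0 <= c by rewrite c_split addr_ge0// sumr_ge0.
rewrite [in leRHS]c_split.
apply: le_trans (leeD (lexx _)
  (expectation_gap_bound n_gt0 model lam0 b0 A0)).
set U := (fun w => (\sum_(i < m) _ + _)%:E).
have mU : measurable_fun [set: Omega] U.
  pose g (z : {i : 'I_m & 'I_(n i)} + 'I_m -> nat) : \bar R :=
    (\sum_(i < m) ((n i)%:R / 2 - a i) / 2
         * (2 * (\sum_(j < n i) lam i j)
            / (row_total (n := n)
                 (fun i j => z (inl (Tagged (fun i => 'I_(n i)) j))) i
               + z (inr i)).+1%:R)
     + (\sum_(i < m) a i - alpha) / 2
         * (2 * (\sum_(i < m) \sum_(j < n i) lam i j)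
            / (\sum_(i < m) (row_total (n := n)
                 (fun i j => z (inl (Tagged (fun i => 'I_(n i)) j))) i
               + z (inr i))%N).+1%:R))%:E.
  exact: (measurable_fun_nat_family (joint_family X Y) g).
have U0 w : (0 <= U w)%E.
  have row_ge0 i : 0 <= \sum_(j < n i) lam i j.
    by rewrite sumr_ge0// => j _; exact: ltW.
  rewrite lee_fin; apply: addr_ge0.
    by apply: sumr_ge0 => i _; rewrite mulr_ge0// divr_ge0// mulr_ge0.
  by rewrite mulr_ge0// divr_ge0// mulr_ge0// sumr_ge0.
have mL := measurable_loss X Y.
have al0 : 0 < alpha by case/andP: alphab; lra.
have a0 i : 0 < a i by have /andP[] := ab i; lra.
have J0 w : 0 <= kl_loss
    (lambda_hat_J R (fun i j => X i j w) (fun i => Y i w)) lam.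
  by apply: kl_loss_ge0 => // i j; exact: lambda_hat_J_gt0.
have H0 w : 0 <= kl_loss
    (lambda_hat alpha a (fun i j => X i j w) (fun i => Y i w)) lam.
  by apply: kl_loss_ge0 => // i j; exact: lambda_hat_gt0.
rewrite /risk unlock -ge0_integralD//; last 2 first.
- by move=> w _; rewrite lee_fin.
- by move=> w _; exact: U0.
(* As [P lam] has mass 1, the constant is an integral too, and each side becomes a single integral
   of a nonnegative function. *)
rewrite -[X in (_ + X <= _)%E](_ : \int[P lam]_w (cst c%:E w) = _)%E;
  last first.
  by rewrite integral_cst//= probability_setT mule1.
rewrite -ge0_integralD//; last first.
  by move=> w _; rewrite lee_fin.
apply: ge0_le_integral => //.
- by move=> w _; rewrite -EFinD lee_fin addr_ge0.
- by apply: emeasurable_funD => //; exact: mL.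
- by apply: emeasurable_funD => //; exact: mL.
- by move=> w _; rewrite -!EFinD lee_fin; exact: kl_loss_gap.
Qed.

Theorem theorem3p2 (R : realType) (m : nat) (n : 'I_m -> nat)
    (m_gt0 : (0 < m)%N) (n_gt0 : forall i, (0 < n i)%N)
    (d : measure_display) (Omega : measurableType d)
    (P : array n R -> probability Omega R)
    (X : array n {mfun Omega >-> nat}) (Y : 'I_m -> {mfun Omega >-> nat})
    (model : poisson_model P X Y)
    (alpha : R) (a : 'I_m -> R)
    (alpha_gt0 : 0 < alpha) (a_gt0 : forall i, 0 < a i)
    (a_bounds : forall i, 1 <= a i <= (n i)%:R / 2)
    (alpha_bounds : 1 <= alpha <= \sum_(i < m) a i)
    (alpha_lt : alpha < (\sum_(i < m) n i)%N%:R / 2) :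
  risk_dominated P X Y (lambda_hat_J R (n := n)) (lambda_hat (n := n) alpha a).
Proof.
set c := ((\sum_(i < m) n i)%N%:R / 2 - alpha) / 2.
have c0 : 0 < c by rewrite /c; lra.
split=> [lam lam0|].
  have := risk_gap n_gt0 model lam0 a_bounds alpha_bounds.
  rewrite -/c => /le_trans gap.
  (* Adding the finite [c] to both sides gives the left side of [risk_gap]; the factor [1 - expR _]
     is at most 1. *)
  rewrite -(leeD2rE _ _ (_ : c%:E \is a fin_num))//.
  by apply: gap; apply: leeD => //; rewrite lee_fin ger_pMr// gerBl.
(* The choice of 1 is arbitrary: strictness comes from [0 < expR _], which holds at every
   parameter. *)
exists (fun _ _ => 1) => [//|].
set lam : array n R := fun _ _ => 1; have lam0 : positive_array lam by [].
have := risk_gap n_gt0 model lam0 a_bounds alpha_bounds.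
rewrite -/c => /le_lt_trans gap.
rewrite -(lteD2rE _ _ (_ : c%:E \is a fin_num))//.
(* The Jeffreys risk cancels because it is finite, leaving [c * (1 - expR _) < c]. *)
apply: gap; rewrite lteD2lE; last first.
  rewrite ge0_fin_numE; first exact: risk_J_fin.
  by apply: risk_ge0 => // x y i j; exact: lambda_hat_J_gt0.
by rewrite lte_fin gtr_pMr// gtrBl expR_gt0.
Qed.
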